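(* For every $n\ge 2$, the path $P_n$ on $n$ vertices satisfies $\chi_\ell^\star(P_n)=2$. For every $n\ge 3$, the cycle $C_n$ on $n$ vertices satisfies $\chi_\ell^\star(C_n)=3$.
   Context: A $k$-list-assignment $L$ of a graph $G$ assigns each vertex a set $L(v)\subseteq\mathbb{N}$ of size $k$; a proper $L$-colouring is a proper colouring $c$ with $c(v)\in L(v)$ for all $v$. The list packing number $\chi_\ell^\star(G)$ is the least $k$ such that for every $k$-list-assignment $L$ of $G$ there exist $k$ proper $L$-colourings $c_1,\dots,c_k$ with $c_i(v)\neq c_j(v)$ for all $v\in V(G)$ and $i\neq j$. *)

(* Defs.v *)
From mathcomp Require Import all_boot finmap.

Set Implicit Arguments.
Unset Strict Implicit.
Unset Printing Implicit Defensive.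

Local Open Scope fset_scope.

Record sgraph := SGraph {
  vertex :> finType;
  adj : rel vertex;
  adj_sym : symmetric adj;
  adj_irrefl : irreflexive adj
}.

Definition list_assignment (G : sgraph) (k : nat) (L : G -> {fset nat}) : Prop :=
  forall v : G, #|` L v| = k.

Definition proper_colouring (G : sgraph) (c : G -> nat) : Prop :=
  forall u v : G, adj u v -> c u <> c v.

Definition proper_list_colouring (G : sgraph) (L : G -> {fset nat})
    (c : G -> nat) : Prop :=
  proper_colouring c /\ forall v : G, c v \in L v.

Definition list_packing (G : sgraph) (k : nat) (L : G -> {fset nat})
    (c : 'I_k -> G -> nat) : Prop :=
  (forall i : 'I_k, proper_list_colouring L (c i)) /\
  (forall (v : G) (i j : 'I_k), i <> j -> c i v <> c j v).

Definition list_packable (G : sgraph) (k : nat) : Prop :=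
  forall L : G -> {fset nat}, list_assignment k L ->
    exists c : 'I_k -> G -> nat, list_packing L c.

(* The list packing number of G equals k.  The minimum ranges over positive
   integers: list_packable G 0 holds vacuously for every G. *)
Definition list_packing_number_is (G : sgraph) (k : nat) : Prop :=
  [/\ 0 < k, list_packable G k
    & forall m : nat, 0 < m -> list_packable G m -> k <= m].

Definition path_adj (n : nat) : rel 'I_n :=
  fun i j => (i.+1 == j :> nat) || (j.+1 == i :> nat).

Lemma path_adj_sym (n : nat) : symmetric (@path_adj n).
Proof. by move=> i j; rewrite /path_adj orbC. Qed.

Lemma path_adj_irrefl (n : nat) : irreflexive (@path_adj n).
Proof. by move=> i; rewrite /path_adj orbb eqn_leq ltnn. Qed.

Definition path_graph (n : nat) : sgraph :=
  SGraph (@path_adj_sym n) (@path_adj_irrefl n).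

(* ordS is the successor modulo n.  The guard i != j only matters for n = 1,
   where ordS has a fixed point. *)
Definition cycle_adj (n : nat) : rel 'I_n :=
  fun i j => (i != j) && ((j == ordS i) || (i == ordS j)).

Lemma cycle_adj_sym (n : nat) : symmetric (@cycle_adj n).
Proof. by move=> i j; rewrite /cycle_adj eq_sym orbC. Qed.

Lemma cycle_adj_irrefl (n : nat) : irreflexive (@cycle_adj n).
Proof. by move=> i; rewrite /cycle_adj eqxx. Qed.

Definition cycle_graph (n : nat) : sgraph :=
  SGraph (@cycle_adj_sym n) (@cycle_adj_irrefl n).

(* Main.v *)
(* A packing is the same as an enumeration of every list such that the
   enumerations at adjacent vertices agree in no position.  For lists of size 2
   these can be chosen greedily along a path.  For lists of size 3, fix the
   enumeration at a first vertex: the enumerations reachable after one edge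
   contain two rotations of a common one, and after two or more edges a full
   rotation class.  If the last list differs from the first, some member of
   that class avoids the first enumeration, and the cycle closes; if no two
   neighbouring lists differ, rotating a single enumeration according to a
   proper 3-colouring of the cycle works. *)

Require Import Defs.
From mathcomp Require Import all_boot finmap.

Set Implicit Arguments.
Unset Strict Implicit.

(** * Sequences compared position by position *)

Definition avoids {T : eqType} : rel (seq T) := all2 (fun a b => a != b).

Definition kset {T : eqType} (k : nat) (s : seq T) : bool :=
  (size s == k) && uniq s.

Lemma all2_rot {S T : Type} (r : S -> T -> bool) (j : nat) (s : seq S) (t : seq T) :
  all2 r s t -> all2 r (rot j s) (rot j t).
Proof.
rewrite !all2E !size_rot => /andP[/eqP st]; rewrite st eqxx /=.
rewrite /rot zip_cat ?size_drop ?st // all_cat -{1}(cat_take_drop j s).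
rewrite -{1}(cat_take_drop j t) zip_cat ?all_cat 1?andbC //.
by rewrite !size_take st.
Qed.

Lemma all2_rcons {S T : Type} (r : S -> T -> bool) (s : seq S) (t : seq T) (a : S) (b : T) :
  all2 r s t -> r a b -> all2 r (rcons s a) (rcons t b).
Proof.
by move=> + ab; elim: s t => [|c s IHs] [|d t] //= => [_|/andP[-> /IHs]]; rewrite ?ab.
Qed.

Lemma all2_nth {S T : Type} (x : S) (y : T) (r : S -> T -> bool) (s : seq S) (t : seq T) (i : nat) :
  all2 r s t -> i < size s -> r (nth x s i) (nth y t i).
Proof.
by elim: s t i => [|a s IHs] [|b t] [|i] //= /andP[ab st]; last exact: IHs.
Qed.

Lemma avoids_sym {T : eqType} : symmetric (@avoids T).
Proof.
by elim=> [|a s IHs] [|b t] //=; rewrite /avoids /= eq_sym; congr andb; apply: IHs.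
Qed.

Lemma perm_kset {T : eqType} (k : nat) (s t : seq T) :
  perm_eq s t -> kset k s = kset k t.
Proof. by rewrite /kset => p; rewrite (perm_uniq p) (perm_size p). Qed.

Lemma kset_last {T : eqType} (k : nat) (l : seq T) (ls : seq (seq T)) :
  kset k l -> all (kset k) ls -> kset k (last l ls).
Proof.
by move=> kl /allP kls; move: (mem_last l ls); rewrite inE => /predU1P[->|/kls].
Qed.

(** * Choosing enumerations across a single edge *)

Lemma neq_eqF {T : eqType} (p q r : T) : p != q -> (p == r) && (q == r) = false.
Proof. by apply: contraNF => /andP[/eqP-> /eqP->]. Qed.

Lemma avoiding_perm2 {T : eqType} (s t : seq T) :
  kset 2 s -> kset 2 t -> exists2 u, perm_eq u t & avoids s u.
Proof.
rewrite /kset; case: s t => [|a [|b []]] // [|x [|y []]] //=; rewrite !inE !andbT => ab xy.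
have [/andP[ax byy]|] := boolP ((a != x) && (b != y)).
  by exists [:: x; y]; rewrite // /avoids /= ax byy.
(* A coincidence in the order [x, y] excludes both coincidences in the swapped order, because
   [a != b] and [x != y]. *)
rewrite negb_and !negbK => axby; exists [:: y; x].
  by rewrite (perm_catC [:: y] [:: x]).
rewrite /avoids /= andbT.
by case/orP: axby => /eqP e; subst; rewrite ?xy ?ab // eq_sym ?ab ?xy // eq_sym.
Qed.

(* Align u with s on the common elements of s and t: a nontrivial rotation of
   u then never agrees with s. *)
Lemma avoiding_rotations {T : eqType} (s t : seq T) :
    kset 3 s -> kset 3 t ->
  exists2 u, perm_eq u t & avoids s (rot 1 u) && avoids s (rot 2 u).
Proof.
rewrite /kset; case: s t => [|a [|b [|c []]]] // [|x [|y [|z []]]] //=.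
rewrite !inE !andbT !negb_or => /andP[/andP[ab ac] bc] /andP[/andP[xy xz] yz].
pose P u := avoids [:: a; b; c] (rot 1 u) && avoids [:: a; b; c] (rot 2 u).
(* Searching over the six orders of the positions makes the existence of [u] a boolean statement,
   decidable from the equalities between entries. *)
suff: has (P \o map (nth x [:: x; y; z])) (permutations [:: 0; 1; 2]).
  case/hasP => sg; rewrite mem_permutations => sgP Psg.
  by exists (map (nth x [:: x; y; z]) sg); rewrite // (perm_map _ sgP).
have -> : permutations [:: 0; 1; 2] =
    [:: [:: 1; 0; 2]; [:: 0; 1; 2]; [:: 2; 0; 1]; [:: 0; 2; 1]; [:: 1; 2; 0]; [:: 2; 1; 0]].
  by [].
rewrite /P /avoids /= !andbT {P}.
(* The equalities between the two sequences form a partial matching; these facts discard every other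
   case of the final split over the nine equalities. *)
move: (neq_eqF x ab) (neq_eqF x ac) (neq_eqF x bc).
move: (neq_eqF y ab) (neq_eqF y ac) (neq_eqF y bc).
move: (neq_eqF z ab) (neq_eqF z ac) (neq_eqF z bc).
move: (neq_eqF a xy) (neq_eqF a xz) (neq_eqF a yz).
move: (neq_eqF b xy) (neq_eqF b xz) (neq_eqF b yz).
move: (neq_eqF c xy) (neq_eqF c xz) (neq_eqF c yz).
rewrite ![x == _]eq_sym ![y == _]eq_sym ![z == _]eq_sym.
by do 3!(case: (_ == x); case: (_ == y); case: (_ == z) => //=).
Qed.

(* An element of t outside s rules out no rotation of t, and each of the other
   two rules out at most one. *)
Lemma avoiding_rotation {T : eqType} (s t : seq T) :
    kset 3 s -> kset 3 t -> ~~ perm_eq s t ->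
  has (fun j => avoids s (rot j t)) (iota 0 3).
Proof.
move=> ks kt nst; have [/andP[/eqP ss us] /andP[/eqP st ut]] := (ks, kt).
have: ~~ all (mem s) t.
  apply: contra nst => /allP ts; rewrite perm_sym; apply: uniq_perm => //.
  by case: (uniq_min_size ut ts _) => //; rewrite ss st.
rewrite /kset in ks kt; case: s t {nst us ss ut st} ks kt => [|a [|b [|c []]]] // [|x [|y [|z []]]] //.
rewrite /avoids /= !inE !andbT !negb_or.
move=> /andP[/andP[ab ac] bc] /andP[/andP[xy xz] yz].
move: (neq_eqF x ab) (neq_eqF x ac) (neq_eqF x bc).
move: (neq_eqF y ab) (neq_eqF y ac) (neq_eqF y bc).
move: (neq_eqF z ab) (neq_eqF z ac) (neq_eqF z bc).
rewrite ![x == _]eq_sym ![y == _]eq_sym ![z == _]eq_sym.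
by do 3!(case: (_ == x); case: (_ == y); case: (_ == z) => //=).
Qed.

(** * Packings of paths and cycles of lists *)

Lemma path_packing {T : eqType} (x : seq T) (ls : seq (seq T)) :
    kset 2 x -> all (kset 2) ls ->
  exists2 ws, all2 perm_eq ws ls & path avoids x ws.
Proof.
elim: ls x => [|l ls IHls] x kx /=; first by exists [::].
case/andP => kl /(IHls _) IH; have [u pul xu] := avoiding_perm2 kx kl.
have [|ws wsls uws] := IH u; first by rewrite (perm_kset _ pul).
by exists (u :: ws); rewrite /= ?pul ?xu.
Qed.

(* The sequence t ends a packing of the path with lists x, ls that starts
   with the enumeration x. *)
Definition reach {T : eqType} (x : seq T) (ls : seq (seq T)) (t : seq T) : Prop :=
  exists ws, [/\ all2 perm_eq ws ls, path avoids x ws & last x ws = t].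

Lemma reach_rcons {T : eqType} (x t u l : seq T) (ls : seq (seq T)) :
  reach x ls t -> avoids t u -> perm_eq u l -> reach x (rcons ls l) u.
Proof.
case=> ws [wsls xws <-] tu ul; exists (rcons ws u).
by rewrite rcons_path xws last_rcons tu all2_rcons.
Qed.

(** With [u] aligned to [t], the two nontrivial rotations of [u] can follow [t]. Rotating
    [avoids t (rot 2 u)] once more shows that [u] itself can follow [rot 1 t]. *)
Lemma reach_rotations_rcons {T : eqType} (x t l : seq T) (ls : seq (seq T)) :
    kset 3 t -> kset 3 l -> reach x ls t -> reach x ls (rot 1 t) ->
  exists2 u, perm_eq u l & forall j, j < 3 -> reach x (rcons ls l) (rot j u).
Proof.
move=> kt kl rt rt1; have [u pul /andP[tu1 tu2]] := avoiding_rotations kt kl.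
have su : size u = 3 by move: kl; rewrite -(perm_kset _ pul) => /andP[/eqP].
exists u => // -[|[|[|]]] // _.
- apply: reach_rcons rt1 _ _; last by rewrite rot0.
  by have := all2_rot 1 tu2; rewrite -rotS ?su // [rot 3 u]rot_oversize ?su // rot0.
- by apply: reach_rcons rt tu1 _; rewrite perm_rot.
- by apply: reach_rcons rt tu2 _; rewrite perm_rot.
Qed.

Lemma reach_rotations {T : eqType} (x l l' : seq T) (ls : seq (seq T)) :
    kset 3 x -> kset 3 l -> kset 3 l' -> all (kset 3) ls ->
  exists2 u, perm_eq u (last l' ls) & forall j, j < 3 -> reach x [:: l, l' & ls] (rot j u).
Proof.
move=> kx kl kl' kls.
have reach0 : reach x [::] x by exists [::].
elim/last_ind: ls kls => [_|ls k IHls] /=.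
  have [u pul /andP[xu1 xu2]] := avoiding_rotations kx kl.
  (* After one edge only [rot 1 u] and [rot 2 u] are known to be reachable; the second is the first
     rotated once, which is what the next extension needs. *)
  have ku : kset 3 (rot 1 u) by rewrite (perm_kset _ (_ : perm_eq _ l)) // perm_rot.
  apply: (reach_rotations_rcons (ls := [:: l]) ku kl').
    by apply: reach_rcons reach0 xu1 _; rewrite perm_rot.
  have /andP[/eqP] := ku; rewrite size_rot => su _.
  by rewrite -rotS ?su //; apply: reach_rcons reach0 xu2 _; rewrite perm_rot.
rewrite all_rcons last_rcons => /andP[kk kls]; have [u pu ru] := IHls kls.
apply: (reach_rotations_rcons (ls := [:: l, l' & ls]) (t := u)) => //.
- by rewrite (perm_kset _ pu) kset_last.
- by have := ru 0 isT; rewrite rot0.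
- exact: ru.
Qed.

Lemma cycle_packing_neq {T : eqType} (x : seq T) (ls : seq (seq T)) :
    1 < size ls -> kset 3 x -> all (kset 3) ls -> ~~ perm_eq x (last x ls) ->
  exists2 ws, all2 perm_eq ws (x :: ls) & cycle avoids ws.
Proof.
case: ls => [|l [|l' ls]] //= _ kx /and3P[kl kl' kls] nx.
have [u pu ru] := reach_rotations kx kl kl' kls.
have ku : kset 3 u by rewrite (perm_kset _ pu) kset_last.
rewrite -(permPr pu) in nx.
have /hasP[j] := avoiding_rotation kx ku nx.
rewrite mem_iota => /= /ru[ws [wsls xws wsl]] xj.
exists (x :: ws); first by rewrite /= perm_refl.
by rewrite /= rcons_path xws wsl avoids_sym.
Qed.

Lemma cycle_packing_const {T : eqType} (x : seq T) (ls : seq (seq T)) :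
    kset 3 x -> ls != [::] -> all (perm_eq x) ls ->
  exists2 ws, all2 perm_eq ws (x :: ls) & cycle avoids ws.
Proof.
move=> kx ls0 xls.
have [xx1 xx2 x12] : [/\ avoids x (rot 1 x), avoids x (rot 2 x) & avoids (rot 1 x) (rot 2 x)].
  rewrite /kset in kx; case: x kx {xls} => [|a [|b [|c []]]] //; rewrite /avoids /= !inE !negb_or.
  rewrite !andbT => /andP[/andP[ab ac] bc].
  by rewrite ab bc ac ![c == _]eq_sym [b == a]eq_sym ab bc ac.
(* Rotation 0 occurs only at the first vertex and rotations 1 and 2 alternate afterwards, so the
   closing edge is harmless for either parity; [b] records which of the two comes last. *)
suff [b [ws [wsls xws e]]] : exists b : bool, reach x ls (rot b.+1 x).
  exists (x :: ws); first by rewrite /= perm_refl.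
  by rewrite /= rcons_path xws e avoids_sym; case: b {e}.
elim/last_ind: ls ls0 xls => // ls l IHls _; rewrite all_rcons => /andP[xl xls].
have [->|/IHls[]// b rb] := eqVneq ls [::].
  by exists false; apply: (@reach_rcons _ x x _ _ [::]); rewrite ?perm_rot //; exists [::].
exists (~~ b); apply: reach_rcons rb _ _; last by rewrite perm_rot.
by case: b; rewrite //= avoids_sym.
Qed.

Lemma cycle_packing {T : eqType} (ls : seq (seq T)) :
    2 < size ls -> all (kset 3) ls ->
  exists2 ws, all2 perm_eq ws ls & cycle avoids ws.
Proof.
case: ls => [|x ls] //= sls /andP[kx kls].
have [xls|] := boolP (all (perm_eq x) ls).
  by apply: cycle_packing_const; rewrite // -size_eq0; case: size sls.
(* The cycle is restarted at the first list [y] that differs from [x] as a set. Its predecessor,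
   which becomes the last list, still has the elements of [x]. *)
rewrite -has_predC => xls; case: (split_find xls) sls kls => y s1 s2 /= nxy.
rewrite has_predC negbK => xs1 sls kls.
have [||||ws wsls cws] := @cycle_packing_neq _ y (s2 ++ x :: s1).
- by move: sls; rewrite !size_cat size_rcons /= addnC !addnS.
- by move: kls; rewrite all_cat all_rcons => /andP[/andP[]].
- by move: kls; rewrite !all_cat all_rcons /= kx => /andP[/andP[_ ->] ->].
- rewrite last_cat /= perm_sym; apply: contra nxy; apply: perm_trans.
  by move: (mem_last x s1); rewrite inE => /predU1P[->|/(allP xs1)].
(* Rotating past [y :: s2] restores the original starting point. *)
exists (rot (size s2).+1 ws); last by rewrite rot_cycle.
rewrite cat_rcons -[x :: _ ++ _]/((x :: s1) ++ y :: s2) -rot_size_cat.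
exact: (all2_rot (size s2).+1 wsls).
Qed.

(** * From sequences of enumerations to graph packings *)

Lemma cycle_nth {T : Type} (x : T) (e : rel T) (s : seq T) (i : nat) :
  cycle e s -> i < size s -> e (nth x s i) (nth x s (i.+1 %% size s)).
Proof.
case: s => [|y s] //= /(pathP x)/(_ i) + lti; rewrite size_rcons => /(_ lti).
rewrite -rcons_cons !nth_rcons /= lti; move: lti; rewrite ltnS leq_eqVlt.
by case/predU1P=> [->|ltis]; rewrite ?ltnn ?eqxx ?modnn // ltis modn_small.
Qed.

(** The [i]-th colouring reads position [i] of every enumeration: avoidance makes it proper, and
    uniqueness within each enumeration separates different colourings. *)
Lemma list_packing_of_seqs (G : sgraph) (k : nat) (L : G -> {fset nat}) (w : G -> seq nat) :
    list_assignment k L -> (forall v, perm_eq (w v) (L v)) ->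
    (forall u v, adj u v -> avoids (w u) (w v)) ->
  exists c : 'I_k -> G -> nat, list_packing L c.
Proof.
move=> Lk wL wadj; exists (fun i v => nth 0 (w v) i).
have sw v : size (w v) = k by rewrite (perm_size (wL v)) -(Lk v).
have uw v : uniq (w v) by rewrite (perm_uniq (wL v)) fset_uniq.
split=> [i|v i j ij].
  split=> [u v /wadj uv|v]; first by apply/eqP/(all2_nth _ _ uv); rewrite sw.
  by rewrite -(perm_mem (wL v)) mem_nth ?sw.
by apply/eqP; rewrite nth_uniq ?sw //; apply/eqP => /val_inj.
Qed.

Definition list_seq (n : nat) (L : 'I_n -> {fset nat}) : seq (seq nat) :=
  [seq (L v : seq nat) | v <- enum 'I_n].

Lemma kset_list_seq (n k : nat) (L : 'I_n -> {fset nat}) :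
  (forall v, #|` L v|%fset = k) -> all (kset k) (list_seq L).
Proof.
by move=> Lk; apply/allP => _ /mapP[v _ ->]; rewrite /kset fset_uniq -(Lk v) eqxx.
Qed.

Lemma size_list_seq (n : nat) (L : 'I_n -> {fset nat}) : size (list_seq L) = n.
Proof. by rewrite size_map size_enum_ord. Qed.

Lemma perm_list_seq (n : nat) (L : 'I_n -> {fset nat}) (ws : seq (seq nat)) (v : 'I_n) :
  all2 perm_eq ws (list_seq L) -> perm_eq (nth [::] ws v) (L v).
Proof.
move=> wsL; have sws : size ws = n.
  by move: wsL; rewrite all2E size_list_seq => /andP[/eqP].
have := all2_nth [::] [::] wsL (_ : v < size ws); rewrite sws => /(_ (ltn_ord v)).
by rewrite (nth_map v) ?size_enum_ord // nth_ord_enum.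
Qed.

Lemma list_packable_path (n : nat) : list_packable (path_graph n) 2.
Proof.
move=> L L2.
have [ws wsL /(sortedP [::]) ews] : exists2 ws, all2 perm_eq ws (list_seq L) & sorted avoids ws.
  have := kset_list_seq L2; case: (list_seq L) => [|l ls] /=; first by exists [::].
  case/andP=> kl kls; have [ws wsls lws] := path_packing kl kls.
  by exists (l :: ws); rewrite //= perm_refl.
have sws : size ws = n.
  by move: wsL; rewrite all2E size_list_seq => /andP[/eqP].
apply: (@list_packing_of_seqs (path_graph n) _ _ (fun v : 'I_n => nth [::] ws v)) => //.
  by move=> v; apply: perm_list_seq.
move=> u v /orP[]/eqP uv; last rewrite avoids_sym.
  by rewrite -uv ews // uv sws ltn_ord.
by rewrite -uv ews // uv sws ltn_ord.
Qed.

Lemma list_packable_cycle (n : nat) : 2 < n -> list_packable (cycle_graph n) 3.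
Proof.
move=> n2 L L3.
have [|ws wsL ews] := cycle_packing _ (kset_list_seq L3); first by rewrite size_list_seq.
have sws : size ws = n.
  by move: wsL; rewrite all2E size_list_seq => /andP[/eqP].
apply: (@list_packing_of_seqs (cycle_graph n) _ _ (fun v : 'I_n => nth [::] ws v)) => //.
  by move=> v; apply: perm_list_seq.
have succ (i : 'I_n) : avoids (nth [::] ws i) (nth [::] ws (ordS i)).
  by have := cycle_nth [::] ews (_ : i < size ws); rewrite sws; apply.
by move=> u v /andP[_] /orP[]/eqP->; last rewrite avoids_sym.
Qed.

(** * Lower bounds *)

Lemma not_list_packable1 (G : sgraph) (u v : G) : adj u v -> ~ list_packable G 1.
Proof.
move=> uv /(_ (fun=> [fset 0]%fset)) [w|c [/(_ ord0)[pc cL] _]]; first exact: cardfs1.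
apply: (pc u v uv).
by move: (cL u) (cL v); rewrite !inE => /eqP-> /eqP->.
Qed.

(* With lists {0,1}, {0,1}, {1,2}, ..., {n-3,n-2}, {n-2,0}, a colouring that
   gives vertex 0 the colour 0 is forced all the way round and gives vertex
   n-1 the colour 0 too. *)
Lemma not_list_packable_cycle2 (n : nat) : 2 < n -> ~ list_packable (cycle_graph n) 2.
Proof.
case: n => [|[|[|n]]] // _.
(* The cycle now has [n.+3] vertices. The remainder alters only the last list, that of vertex
   [n.+2], which becomes [{n.+1, 0}]. *)
pose L (v : 'I_n.+3) : {fset nat} :=
  (if v : nat is j.+1 then [fset j; v %% n.+2] else [fset 0; 1])%fset.
move=> /(_ L)[v|c [proper distinct]].
  rewrite /L; case: v => -[|j] jn /=; rewrite cardfs2 //.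
  move: jn; rewrite !ltnS leq_eqVlt => /predU1P[->|jn]; first by rewrite modnn.
  by rewrite modn_small // neq_ltn ltnSn.
(* The two colourings use different elements of [{0, 1}] at vertex 0, so one of them uses 0. *)
have [i ci0] : exists i, c i ord0 = 0.
  have [[_ L0] [_ L1]] := (proper ord0, proper ord_max).
  have := distinct ord0 ord0 ord_max; move: (L0 ord0) (L1 ord0); rewrite !inE.
  case/orP=> /eqP c0; first by exists ord0.
  case/orP=> /eqP c1; first by exists ord_max.
  by rewrite c0 c1 => /(_ _ erefl)[].
have [pc cL] := proper i.
(* Inductively vertex [m] has colour [m], so vertex [m.+1] must take the other element of its
   list. *)
have forced m (mn : m < n.+3) : c i (Ordinal mn) = m %% n.+2.
  elim: m mn => [|m IHm] mn; first by rewrite mod0n -[RHS]ci0; congr (c i _); apply: val_inj.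
  have := cL (Ordinal mn); rewrite !inE => /orP[]/eqP // cm.
  case: (pc (Ordinal (ltnW mn)) (Ordinal mn)); last by rewrite IHm cm modn_small.
  by rewrite /= /cycle_adj -val_eqE /= neq_ltn ltnSn -val_eqE /= modn_small ?eqxx.
apply: (pc (Ordinal (ltnSn n.+2)) ord0); last by rewrite forced modnn ci0.
by rewrite /= /cycle_adj -!val_eqE /= modnn.
Qed.

Theorem theorem13 :
  (forall n : nat, 2 <= n -> list_packing_number_is (path_graph n) 2) /\
  (forall n : nat, 3 <= n -> list_packing_number_is (cycle_graph n) 3).
Proof.
split=> n n2; split=> //.
- exact: list_packable_path.
- case: n n2 => [|[|n]] // _ [|[|m]] // _.
  by move/(@not_list_packable1 (path_graph n.+2) ord0 (Ordinal (isT : 1 < n.+2)) isT).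
- exact: list_packable_cycle.
move=> [|[|[|m]]] // _; last by move/(not_list_packable_cycle2 n2).
case: n n2 => [|[|[|n]]] // _.
by move/(@not_list_packable1 (cycle_graph n.+3) ord0 (Ordinal (isT : 1 < n.+3)) isT).
Qed.
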